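(* Let $a>1$ and $d>1$ be integers such that $d$ is odd and $\gcd(a,d)=1$. Let $\mathcal{P}_{a,d}=\{a+kd : k\in\mathbb{Z}\}$, and let $f:\mathbb{Z}\to\mathbb{C}$ be a multiplicative function such that $f(a)\neq 0$. Then $$f(u+v)=f(u)+f(v)\quad\text{for all } u,v\in\mathcal{P}_{a,d}$$ if and only if there exists a Dirichlet character $\chi_d$ modulo $d$ with $\chi_d(2)=1$ such that $$f(n)=n\,\chi_d(n)\quad\text{for all integers } n \text{ with } \gcd(n,d)=1.$$ For $n$ with $\gcd(n,d)\neq 1$, $f(n)$ takes arbitrary values subject to the multiplicativity of $f$; that is, for any Dirichlet character $\chi_d$ modulo $d$ with $\chi_d(2)=1$, every multiplicative function $f:\mathbb{Z}\to\mathbb{C}$ with $f(n)=n\chi_d(n)$ for all $n$ coprime to $d$ satisfies $f(u+v)=f(u)+f(v)$ for all $u,v\in\mathcal{P}_{a,d}$, whatever its values at integers not coprime to $d$.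
   Context: A function $f:\mathbb{Z}\to\mathbb{C}$ is multiplicative if $f(mn)=f(m)f(n)$ whenever $\gcd(m,n)=1$. *)

(* Defs.v *)
(* The complex numbers are R[i] over an arbitrary R : realType, i.e. over the
   real numbers. *)
From HB Require Import structures.
From mathcomp Require Import all_boot all_order all_algebra.
From mathcomp Require Import complex.
From mathcomp Require Import reals.

Set Implicit Arguments.
Unset Strict Implicit.
Unset Printing Implicit Defensive.

Import GRing.Theory Num.Theory.
Local Open Scope ring_scope.

Definition arith_progression (a d n : int) : Prop :=
  exists k : int, n = a + k * d.

(* Not complete multiplicativity: only coprime factors are constrained.  The
   arguments range over all integers, including negative ones and 0, where
   gcd(m, 0) = |m|. *)
Definition multiplicative_fun (R : realType) (f : int -> R[i]) : Prop :=
  forall m n : int, coprimez m n -> f (m * n) = f m * f n.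

(* The character is extended by 0 to the integers not coprime to d;
   chi 1 = 1 is a consequence of the last two conditions. *)
Definition dirichlet_character (R : realType) (d : int) (chi : int -> R[i]) :
    Prop :=
  [/\ forall m n : int, (m = n %[mod d])%Z -> chi m = chi n,
      forall m n : int, chi (m * n) = chi m * chi n
    & forall n : int, chi n <> 0 <-> coprimez n d].

(* Main.v *)
Require Import Defs.
From HB Require Import structures.
From mathcomp Require Import all_boot all_order all_algebra.
From mathcomp Require Import complex.
From mathcomp Require Import reals.
From mathcomp Require Import cyclic ring.

Set Implicit Arguments.
Unset Strict Implicit.
Unset Printing Implicit Defensive.

Import GRing.Theory Num.Theory.
Local Open Scope ring_scope.

(** If f is additive on the progression P of a modulo d, then f (u) + f (v)
    depends only on u + v for u, v in P, so f is affine on P: f (n + l d) =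
    f (n) + l c for n in P, with a fixed slope c ([additive_affine]).
    Doubling an odd n in P where f (n) <> 0 gives f (2) = 2 ([additive_two]);
    such an n exists because d is odd.

    Now let m = 1 modulo d and compare f (m n) = f (m) f (n), for n in P
    coprime to m, with the affine formula.  The two sides grow with n at rates
    proportional to m c and f (m) c.  Hence f (m) = m for all such m if c <> 0,
    while if c = 0 then f is the nonzero constant f (a) on P and f (m) = 1.

    In either case f divided by a completely multiplicative function (the
    identity or 1) is a multiplicative function with value 1 on the class of
    1, and any such function is a Dirichlet character on the integers coprime
    to d ([dirichlet_character_of_trivial_on_1]).  If c = 0 this character is
    f itself there, so f (2) = 2 would have to be a root of unity
    ([dirichlet_character_exp_totient]), which is impossible.  If c <> 0 the
    character is f (n) / n, whose value at 2 is 1.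

    Conversely, if f (n) = n chi (n) with chi (2) = 1, then for u, v in P the
    sum u + v lies in the class of 2 a, which is coprime to d since d is odd,
    and chi (2 a) = chi (a) is the common value of chi at u, v and u + v. *)

(** * Residue classes coprime to the modulus *)

Lemma eq_modz_progression (a d n : int) :
  (n = a %[mod d])%Z <-> arith_progression a d n.
Proof.
split=> [/eqP|[k ->]]; last by rewrite addrC modzMDl.
rewrite eqz_mod_dvd => /dvdzP[k nak]; exists k.
by rewrite -nak; ring.
Qed.

Lemma coprimez1l (d : int) : coprimez 1 d.
Proof. by rewrite /coprimez gcd1z. Qed.

Lemma coprimez_eq_mod (m n d : int) :
  (m = n %[mod d])%Z -> coprimez m d = coprimez n d.
Proof. by rewrite /coprimez => mn; rewrite -gcdz_modl mn gcdz_modl. Qed.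

Lemma coprimezDr (m n k : int) : coprimez m (n + k * m) = coprimez m n.
Proof.
by rewrite coprimez_sym (@coprimez_eq_mod _ n) 1?coprimez_sym // addrC modzMDl.
Qed.

Lemma coprime_representative (d M r : int) : coprimez M d ->
  exists2 n : int, (n = r %[mod d])%Z & coprimez n M.
Proof.
move=> cMd; exists (zchinese M d 1 r); first exact: zchinese_modr.
by rewrite (coprimez_eq_mod (zchinese_modl cMd 1 r)) coprimez1l.
Qed.

Lemma coprime_inverse (d M m : int) : coprimez M d -> coprimez m d ->
  exists n : int, [/\ (m * n = 1 %[mod d])%Z, coprimez n d & coprimez n M].
Proof.
move=> cMd /coprimezP[[x y] /= xy1].
have [n nx cnM] := coprime_representative x cMd.
have mn1 : (m * n = 1 %[mod d])%Z.
  by rewrite -modzMmr nx modzMmr -xy1 addrC modzMDl mulrC.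
exists n; split=> //.
have : coprimez (m * n) d by rewrite (coprimez_eq_mod mn1) coprimez1l.
by rewrite coprimezMl => /andP[].
Qed.

(** * Dirichlet characters *)

Section Character.
Variables (R : realType) (d : int).

Lemma dirichlet_character1 (chi : int -> R[i]) :
  dirichlet_character d chi -> chi 1 = 1.
Proof.
case=> _ chiM chi0; apply: (@mulfI _ (chi 1)).
  by apply/eqP/chi0; rewrite coprimez1l.
by rewrite -chiM !mulr1.
Qed.

Lemma dirichlet_characterX (chi : int -> R[i]) (n : int) (k : nat) :
  dirichlet_character d chi -> chi (n ^+ k) = chi n ^+ k.
Proof.
move=> chiP; elim: k => [|k IHk]; first by rewrite !expr0 dirichlet_character1.
by case: chiP => _ chiM _; rewrite !exprS chiM IHk.
Qed.

Lemma dirichlet_character_exp_totient (chi : int -> R[i]) (n : nat) :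
  dirichlet_character d chi -> coprimez n d -> chi n ^+ totient `|d| = 1.
Proof.
move=> chiP cnd; rewrite -(dirichlet_characterX _ _ chiP).
rewrite -[RHS](dirichlet_character1 chiP).
case: chiP => chi_mod _ _; apply: chi_mod.
rewrite -!(modz_abs _ d) -[n%:Z]natz -natrX natz.
by rewrite !modz_nat Euler_exp_totient // -coprimezE.
Qed.

(** If m = m' modulo d, pick n inverse to both modulo d and coprime to m m':
    then g m * g n = 1 = g m' * g n, so g depends only on the class.  Total
    multiplicativity follows by moving one factor within its class until the
    two factors are coprime. *)
Lemma dirichlet_character_of_trivial_on_1 (g : int -> R[i]) :
  (forall m n : int, coprimez m d -> coprimez n d -> coprimez m n ->
     g (m * n) = g m * g n) ->
  (forall m : int, (m = 1 %[mod d])%Z -> g m = 1) ->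
  dirichlet_character d (fun n => if coprimez n d then g n else 0).
Proof.
move=> gM g1.
have g_inv m M : coprimez M d -> coprimez m d ->
    exists n : int, [/\ (m * n = 1 %[mod d])%Z, coprimez n d, coprimez n M
      & g m * g n = 1].
  move=> cMd cmd.
  have [||n [mn1 cnd]] := @coprime_inverse d (M * m) m; rewrite ?coprimezMl ?cMd //.
  rewrite coprimezMr => /andP[cnM cnm]; exists n; split=> //.
  by rewrite -gM ?g1 // coprimez_sym.
have g_neq0 m : coprimez m d -> g m != 0.
  move=> cmd; have [n [_ _ _ gmn]] := g_inv m m cmd cmd.
  by apply: contra_eq_neq gmn => ->; rewrite mul0r eq_sym oner_eq0.
have g_mod m m' : coprimez m d -> (m = m' %[mod d])%Z -> g m = g m'.
  move=> cmd mm'; have cm'd : coprimez m' d by rewrite -(coprimez_eq_mod mm').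
  have [n [mn1 cnd cnm' gmn]] := g_inv m m' cm'd cmd.
  apply: (@mulIf _ (g n)); first exact: g_neq0.
  by rewrite gmn -gM // 1?coprimez_sym // g1 // -modzMml -mm' modzMml.
split=> [m n mn|m n|n].
- rewrite (coprimez_eq_mod mn); case: ifP => // cnd.
  by apply: g_mod; rewrite ?(coprimez_eq_mod mn).
- rewrite coprimezMl.
  case: (boolP (coprimez m d)) => [cmd|_]; last by rewrite mul0r.
  case: (boolP (coprimez n d)) => [cnd|_]; last by rewrite mulr0.
  have [n' n'n cn'm] := coprime_representative n cmd.
  have cn'd : coprimez n' d by rewrite (coprimez_eq_mod n'n).
  rewrite /= -(g_mod n' n) // -gM // 1?coprimez_sym //.
  by apply: g_mod; rewrite ?coprimezMl ?cmd // -modzMmr -n'n modzMmr.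
by case: ifP => [/g_neq0/eqP|].
Qed.

End Character.

(** * Functions additive on an arithmetic progression *)

(** The hypothesis says that h - h 0 is an additive map on the integers,
    hence multiplication by its value at 1. *)
Lemma affine_of_additive (V : zmodType) (h : int -> V) :
  (forall k l : int, h (k + l) + h 0 = h k + h l) ->
  forall k l : int, h (k + l) = h k + (h 1 - h 0) *~ l.
Proof.
move=> hD k l.
have hS j : h (j + 1) = h j + (h 1 - h 0).
  by apply: (addIr (h 0)); rewrite hD addrA subrK.
elim/int_rect: l => [|n IHn|n IHn]; first by rewrite addr0 mulr0z addr0.
- by rewrite intS [1 + _]addrC addrA hS IHn mulrzDr mulr1z -[LHS]addrA.
apply: (addIr (h 1 - h 0)); rewrite -hS.
have -> : k + - n.+1%:Z + 1 = k - n%:Z by rewrite intS; ring.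
rewrite IHn -addrA; congr (_ + _).
by rewrite -[X in _ = _ + X]mulr1z -mulrzDr intS; congr (_ *~ _); ring.
Qed.

Section AdditiveOnProgression.
Variables (R : realType) (a d : int) (f : int -> R[i]).
Hypothesis fD : forall u v : int,
  arith_progression a d u -> arith_progression a d v -> f (u + v) = f u + f v.

Lemma additive_affine : exists c : R[i], forall n l : int,
  arith_progression a d n -> f (n + l * d) = f n + c *~ l.
Proof.
pose h k := f (a + k * d).
have hD k l : h (k + l) + h 0 = h k + h l.
  rewrite /h -!fD; try by [exists (k + l)|exists 0|exists k|exists l].
  by congr f; ring.
exists (h 1 - h 0) => _ l [k ->].
by rewrite -[f (a + k * d)]/(h k) -affine_of_additive // /h; congr f; ring.
Qed.

Variable c : R[i].
Hypothesis f_affine : forall n l : int,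
  arith_progression a d n -> f (n + l * d) = f n + c *~ l.
Hypothesis fM : multiplicative_fun f.
Hypothesis fa_neq0 : f a != 0.

(** An affine function with two zeros vanishes identically, which f a
    excludes. *)
Lemma progression_nonzero (n l : int) : l != 0 -> arith_progression a d n ->
  f n != 0 \/ f (n + l * d) != 0.
Proof.
move=> l_neq0 nP; have [fn0|?] := eqVneq (f n) 0; [right|by left].
rewrite f_affine // fn0 add0r; have [c0|c_neq0] := eqVneq c 0.
  move: nP fa_neq0 => [k nE]; have := fn0; rewrite nE f_affine; last first.
    by exists 0; rewrite mul0r addr0.
  by rewrite c0 mul0rz addr0 => ->; rewrite eqxx.
by rewrite -mulrzr mulf_neq0 // intr_eq0.
Qed.

Lemma additive_two : coprimez 2 d -> f 2 = 2.
Proof.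
move=> c2d.
have dbl n : arith_progression a d n -> coprimez n 2 -> f n != 0 -> f 2 = 2.
  move=> nP cn2 fn; apply: (mulIf fn); rewrite -fM // 1?coprimez_sym //.
  by rewrite [RHS]mulr_natl [RHS]mulr2n -fD //; congr f; ring.
have [n /eq_modz_progression nP cn2] := coprime_representative a c2d.
(* The step 2 keeps n odd. *)
have [] := @progression_nonzero n 2 isT nP; first exact: dbl.
apply: dbl; last by rewrite coprimez_sym mulrC coprimezDr coprimez_sym.
by case: nP => k ->; exists (k + 2); ring.
Qed.

Section ClassOfOne.
Variable m : int.
Hypothesis m1 : (m = 1 %[mod d])%Z.

Let cmd : coprimez m d.
Proof. by rewrite (coprimez_eq_mod m1) coprimez1l. Qed.

Let mulm_progression (n : int) :
  arith_progression a d n -> arith_progression a d (m * n).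
Proof.
move/eq_modz_progression => na; apply/eq_modz_progression.
by rewrite -modzMml m1 modzMml mul1r.
Qed.

(** The points n and n + m d of the progression are both coprime to m: the
    increment of f between them is m c, and between their multiples by m it is
    m^2 c. *)
Lemma slope_neq0_class_of_one : m != 0 -> c != 0 -> f m = m%:~R.
Proof.
move=> m_neq0 c_neq0.
have [n /eq_modz_progression nP cnm] := coprime_representative a cmd.
have cmn : coprimez m n by rewrite coprimez_sym.
have cmn' : coprimez m (n + (d * m)) by rewrite coprimezDr.
have := fM cmn'; rewrite mulrDr.
have -> : m * (d * m) = (m * m) * d by ring.
have -> : d * m = m * d by ring.
rewrite !f_affine ?fM //; last exact: mulm_progression.
rewrite mulrDr => /addrI; rewrite mulrzA -[LHS]mulrzl => /mulIf ->//.
by rewrite -mulrzr mulf_neq0 // intr_eq0.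
Qed.

Lemma slope_eq0_class_of_one : c = 0 -> f m = 1.
Proof.
move=> c0.
have f_const n : arith_progression a d n -> f n = f a.
  case=> k ->; rewrite f_affine ?c0 ?mul0rz ?addr0 //.
  by exists 0; rewrite mul0r addr0.
have [n /eq_modz_progression nP cnm] := coprime_representative a cmd.
apply: (mulIf fa_neq0); rewrite mul1r -[in LHS](f_const n) // -fM // 1?coprimez_sym //.
exact/f_const/mulm_progression.
Qed.

End ClassOfOne.

End AdditiveOnProgression.

(** * Characterisation *)

Theorem theorem1 (R : realType) (a d : int)
    (a_gt1 : 1 < a) (d_gt1 : 1 < d) (d_odd : ~~ (2 %| d)%Z)
    (coprime_ad : coprimez a d) :
  (forall f : int -> R[i], multiplicative_fun f -> f a <> 0 ->
     ((forall u v : int, arith_progression a d u -> arith_progression a d v ->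
         f (u + v) = f u + f v)
      <->
      (exists chi : int -> R[i],
         [/\ dirichlet_character d chi, chi 2 = 1
           & forall n : int, coprimez n d -> f n = n%:~R * chi n])))
  /\
  (forall chi : int -> R[i], dirichlet_character d chi -> chi 2 = 1 ->
     forall f : int -> R[i], multiplicative_fun f ->
       (forall n : int, coprimez n d -> f n = n%:~R * chi n) ->
       forall u v : int, arith_progression a d u -> arith_progression a d v ->
         f (u + v) = f u + f v).
Proof.
have c2d : coprimez 2 d by rewrite coprimezE prime_coprime.
have absd_gt1 : (1 < `|d|)%N by move: d_gt1; case: (d).
have coprimez_neq0 n : coprimez n d -> n != 0.
  apply: contraTneq => ->; rewrite coprimezE /coprime gcd0n.
  by rewrite neq_ltn absd_gt1 orbT.
have char_additive chi : dirichlet_character d chi -> chi 2 = 1 ->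
     forall f : int -> R[i],
       (forall n : int, coprimez n d -> f n = n%:~R * chi n) ->
       forall u v : int, arith_progression a d u -> arith_progression a d v ->
         f (u + v) = f u + f v.
  move=> [chi_mod chiM _] chi2 f fE u v /eq_modz_progression ua
    /eq_modz_progression va.
  have uv2a : (u + v = 2 * a %[mod d])%Z.
    by rewrite -modzDm ua va modzDm mulr_natl mulr2n.
  rewrite !fE ?(coprimez_eq_mod uv2a) ?(coprimez_eq_mod ua)
    ?(coprimez_eq_mod va) ?coprimezMl ?c2d //.
  by rewrite (chi_mod _ _ uv2a) (chi_mod _ _ ua) (chi_mod _ _ va) chiM chi2
    mul1r rmorphD mulrDl.
split=> [f fM /eqP fa_neq0|chi chiP chi2 f _]; last exact: char_additive.
split=> [fD|[chi [chiP chi2 fE]]]; last exact: (char_additive chi).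
have [c f_affine] := additive_affine fD.
have f2 : f 2 = 2 by apply: (additive_two fD f_affine).
have [c0|c_neq0] := eqVneq c 0.
  (* f would be a character with value 2 at 2, and a power of 2 with positive
     exponent is even, hence not 1. *)
  have f1 m := slope_eq0_class_of_one f_affine fM fa_neq0 (m := m) ^~ c0.
  have chiP : dirichlet_character d (fun n => if coprimez n d then f n else 0).
    by apply: dirichlet_character_of_trivial_on_1 => [m n _ _ /fM|].
  have := dirichlet_character_exp_totient (n := 2) chiP c2d.
  rewrite /= c2d f2 -natrX => /eqP; rewrite -[1]/(1%:R) eqr_nat => /eqP.
  have : (0 < totient `|d|)%N by rewrite totient_gt0 ltnW.
  by case: (totient _) => // k _; rewrite expnS => /(congr1 odd); rewrite oddM.
have f1 m (m1 : (m = 1 %[mod d])%Z) : f m = m%:~R.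
  apply: (slope_neq0_class_of_one f_affine fM m1) => //.
  by apply: coprimez_neq0; rewrite (coprimez_eq_mod m1) coprimez1l.
have intr_neq0 n : coprimez n d -> n%:~R != 0 :> R[i].
  by move=> /coprimez_neq0; rewrite intr_eq0.
exists (fun n => if coprimez n d then f n / n%:~R else 0); split.
- apply: dirichlet_character_of_trivial_on_1 => [m n _ _ cmn|m m1].
    by rewrite fM // intrM invfM mulrACA.
  by rewrite f1 // divff // intr_neq0 // (coprimez_eq_mod m1) coprimez1l.
- by rewrite c2d f2 divff // pnatr_eq0.
- by move=> n cnd; rewrite cnd mulrC divfK // intr_neq0.
Qed.
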